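(* Let $p^*\in(0,1)$, let $n\ge1$ be the number of pre-specified Kolmogorov–Smirnov tests, and let $T$ be the run time, a positive integer multiple of $n$. Suppose the absence-confirmation algorithm described in the context is run in an environment containing no source. Then its false positive rate, i.e. the probability that it returns $1$ (''anomaly detected''), is at most $p^*$.
   Context: Parameters: background $B\ge0$, outer dimensions of the environment, confidence parameter $p^*$, run time $T$, test count $n$, threshold level $z\in\mathbb{R}$, step constants $0\le c_L<c_U$, and a reference distribution $V_r$. Measurement model. In an environment with a source of strength $s\ge 0$, a measurement at robot position $(x,y)$ is Poisson distributed with mean $B+g(s,x,y)$, where $g\ge0$ and $g=0$ if $s=0$. Hence in a source-free environment, conditionally on the environment, the position and the entire past, each measurement is Poisson with mean $B$. The value of $B$ used by the algorithm is the true background. Algorithm. Initialize $\underline{p}=1$ and $V_e$ empty. For $t=1,2,\dots,T$: (1) take a measurement $N_t$ at the current position; (2) set $c=c_U$ if $N_t\le B+z\sqrt{B}$, and $c=c_L$ otherwise; (3) draw $ds_t$ uniformly from $[0,c]$ and $d\theta_t$ uniformly from $[0,2\pi]$; given $N_t$, these are independent of each other and of the environment, the position and the past (the uniform law on $[0,0]$ is the point mass at $0$); (4) rotate by $d\theta_t$ and move forward a distance $ds_t$, randomly redirecting at obstacles and travelling the remaining distance, so that the new position may depend on the environment in an arbitrary (measurable) way; (5) append $ds_t$ to $V_e$; (6) if $t$ is a multiple of $T/n$, set $\underline{p}\leftarrow\min\{\underline{p},\mathbf{KS}(V_e,V_r)\}$; (7) if $\underline{p}\le p^*/n$, stop and return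 $1$ (''anomaly detected''). If the loop ends without stopping, return $0$ (''absence confirmed''). Reference distribution. $V_r$ is the source-free distribution of a step size: the law of $ds$ obtained by drawing $N\sim\mathrm{Poisson}(B)$ and then $ds$ uniform on $[0,c_U]$ if $N\le B+z\sqrt B$, and uniform on $[0,c_L]$ otherwise. KS test. $\mathbf{KS}(V_e,V_r)$ is the P-value of the Kolmogorov–Smirnov test of the null hypothesis that the recorded steps $V_e=(ds_1,\dots,ds_t)$ are an i.i.d. sample from $V_r$. That is, it is the probability that the Kolmogorov–Smirnov statistic (the supremum distance between the empirical distribution function and that of $V_r$) of an i.i.d. sample of size $t$ from $V_r$ is at least the observed value of the statistic. The individual tests are performed at significance level $p^*/n$. *)

(* Defs.v *)
From HB Require Import structures.
From mathcomp Require Import all_boot all_order all_algebra.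
From mathcomp Require Import all_classical all_reals all_analysis.

Set Implicit Arguments.
Unset Strict Implicit.
Unset Printing Implicit Defensive.

Import Order.TTheory GRing.Theory Num.Theory.
Import numFieldNormedType.Exports.

Local Open Scope classical_set_scope.
Local Open Scope ring_scope.

Section step_law.
Context {R : realType}.

(* Uniform law on [0, c]; the point mass at 0 when c = 0 (it is never used
   with c < 0). *)
Definition uniform_from0 (c : R) : probability (measurableTypeR R) R :=
  match pselect (0 < c) with
  | left c_gt0 => uniform_prob c_gt0
  | right _ => dirac (0 : measurableTypeR R)
  end.

(* The second argument of poisson_prob is a dummy; poisson_prob 0 is the point
   mass at 0, i.e. the Poisson law of mean 0. *)
Definition poisson (mean : R) : probability nat R := poisson_prob mean 0%N.

Definition step_bound (B z cL cU : R) (N : nat) : R :=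
  if N%:R <= B + z * Num.sqrt B then cU else cL.

(* The reference distribution V_r: draw N ~ Poisson(B), then draw uniformly on
   [0, step_bound N]. *)
Definition ref_law (B z cL cU : R) : set (measurableTypeR R) -> \bar R :=
  fun U => (\int[poisson B]_N uniform_from0 (step_bound B z cL cU N) U)%E.

Section ref_law_probability.
Variables B z cL cU : R.
Local Open Scope ereal_scope.

Let ref_law0 : ref_law B z cL cU set0 = 0.
Proof. by apply: integral0_eq => N _; rewrite measure0. Qed.

Let ref_law_ge0 U : 0 <= ref_law B z cL cU U.
Proof. exact: integral_ge0. Qed.

Let ref_law_sigma_additive : semi_sigma_additive (ref_law B z cL cU).
Proof.
move=> F mF tF mUF; rewrite /ref_law; apply: cvg_toP.
  apply: ereal_nondecreasing_is_cvgn => a b ab.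
  by apply: lee_sum_nneg_natr => // n _ _; exact: integral_ge0.
rewrite -integral_nneseries//.
apply: eq_integral => N _.
by apply/cvg_lim => //; exact: measure_semi_sigma_additive.
Qed.

HB.instance Definition _ := isMeasure.Build _ _ _ (ref_law B z cL cU)
  ref_law0 ref_law_ge0 ref_law_sigma_additive.

Let ref_law_setT : ref_law B z cL cU [set: _] = 1.
Proof.
rewrite /ref_law; under eq_integral do rewrite probability_setT.
by rewrite integral_cst// mul1e; exact: probability_setT.
Qed.

HB.instance Definition _ := Measure_isProbability.Build _ _ _
  (ref_law B z cL cU) ref_law_setT.

End ref_law_probability.

End step_law.

Section kolmogorov_smirnov.
Context {R : realType}.

Definition cons_pair n (p : measurableTypeR R * n.-tuple (measurableTypeR R)) :
  n.+1.-tuple (measurableTypeR R) := [tuple of p.1 :: p.2].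

Lemma measurable_cons_pair n : measurable_fun setT (@cons_pair n).
Proof. exact: measurable_cons. Qed.

HB.instance Definition _ n :=
  isMeasurableFun.Build _ _ _ _ (@cons_pair n) (@measurable_cons_pair n).

(* Law of an i.i.d. sample of size n from mu. *)
Fixpoint iid_law (mu : probability (measurableTypeR R) R) (n : nat) :
    probability (n.-tuple (measurableTypeR R)) R :=
  match n with
  | 0%N => dirac [tuple]
  | m.+1 => distribution (mu \x iid_law mu m)%E (@cons_pair m)
  end.

Definition ecdf (v : seq R) (x : R) : R :=
  (count (fun y => y <= x) v)%:R / (size v)%:R.

Definition ks_stat (mu : probability (measurableTypeR R) R) (v : seq R) : R :=
  sup (range (fun x => `|ecdf v x - fine (mu `]-oo, x]%classic)|)).

Definition ks_pvalue (mu : probability (measurableTypeR R) R) (v : seq R) :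
    \bar R :=
  iid_law mu (size v)
    [set w : (size v).-tuple (measurableTypeR R) | ks_stat mu v <= ks_stat mu w].

End kolmogorov_smirnov.

Section algorithm.
Context {R : realType}.
Variables (B z cL cU pstar : R) (n T : nat).

Record alg_state := AlgState {
  steps : seq R;
  plow : \bar R;
  stopped : bool }.

(* Steps (5)-(7) of iteration t, given the step size ds drawn in it.  A stopped
   state is final. *)
Definition alg_step (t : nat) (ds : R) (st : alg_state) : alg_state :=
  if stopped st then st else
  let V := rcons (steps st) ds in
  let p := if (T %/ n %| t)%N
           then Order.min (plow st) (ks_pvalue (ref_law B z cL cU) V)
           else plow st in
  AlgState V p (p <= (pstar / n%:R)%:E)%E.

(* State after k iterations, ds t being the step size drawn in iteration t. *)
Fixpoint alg_run (ds : nat -> R) (k : nat) : alg_state :=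
  match k with
  | 0%N => AlgState [::] 1%E false
  | j.+1 => alg_step j.+1 (ds j.+1) (alg_run ds j)
  end.

(* 1 is "anomaly detected", 0 is "absence confirmed". *)
Definition alg_output (ds : nat -> R) : nat :=
  if stopped (alg_run ds T) then 1%N else 0%N.

End algorithm.

(* A pose ((x, y), a) is a position (x, y) with a heading a. *)
Notation pose_type R :=
  (measurableTypeR R * measurableTypeR R * measurableTypeR R)%type.

Definition rotate (R : realType) (p : pose_type R) (da : R) : pose_type R :=
  (p.1, p.2 + da).

Section conditional_law.
Context d d' (Omega : measurableType d) (Y : measurableType d') (R : realType).

Definition preimages (X : Omega -> Y) : set (set Omega) :=
  preimage_set_system setT X measurable.

(* On the event D, the kernel kappa is a version of the conditional law of X
   given the sigma-algebra F. *)
Definition conditional_law_on (P : probability Omega R) (F : set (set Omega))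
    (D : set Omega) (X : Omega -> Y) (kappa : Omega -> set Y -> \bar R) :=
  forall (A : set Omega) (U : set Y), F A -> A `<=` D -> measurable U ->
    P (A `&` X @^-1` U) = (\int[P]_(w in A) kappa w U)%E.

End conditional_law.

(* The random quantities of a run.  Iterations are numbered from 1: pose_at t
   is the pose at which measurement number t is taken, and noise t is the
   randomness used to redirect the robot at obstacles in iteration t.  The
   values of the variables after the run has stopped are irrelevant. *)
Record trajectory d dE dX (Omega : measurableType d) (E : measurableType dE)
    (X : measurableType dX) (R : realType) (P : probability Omega R) :=
  Trajectory {
  env : {RV P >-> E};
  pose_at : nat -> {RV P >-> pose_type R};
  meas : nat -> {RV P >-> nat};
  dstep : nat -> {RV P >-> measurableTypeR R};
  dangle : nat -> {RV P >-> measurableTypeR R};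
  noise : nat -> {RV P >-> X} }.

Section run.
Context d dE dX (Omega : measurableType d) (E : measurableType dE)
  (X : measurableType dX) (R : realType) (P : probability Omega R).
Variables (B z cL cU pstar : R) (n T : nat).
Variables (strength : E -> R) (g : R -> R -> R -> R).
Variable move : E * pose_type R * measurableTypeR R * X -> pose_type R.
Variable tr : trajectory E X P.

(* Events determined by the environment, the current pose and all that happened
   in the iterations 1, ..., t - 1. *)
Definition past (t : nat) : set (set Omega) :=
  <<s preimages (env tr)
      `|` \bigcup_(i in [set i | (1 <= i <= t)%N]) preimages (pose_at tr i)
      `|` \bigcup_(i in [set i | (1 <= i < t)%N])
            (preimages (meas tr i) `|` preimages (dstep tr i)
             `|` preimages (dangle tr i) `|` preimages (noise tr i)) >>.

Definition past_and_meas (t : nat) : set (set Omega) :=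
  <<s past t `|` preimages (meas tr t) >>.

(* Iteration t is executed. *)
Definition executed (t : nat) : set Omega :=
  [set w | ~~ stopped
    (alg_run B z cL cU pstar n T (fun i => dstep tr i w) t.-1)].

Record is_run : Prop := IsRun {
  meas_law : forall t, (1 <= t <= T)%N ->
    conditional_law_on P (past t) (executed t) (meas tr t)
      (fun w => let p := pose_at tr t w in
         poisson (B + g (strength (env tr w)) p.1.1 p.1.2));
  draw_law : forall t, (1 <= t <= T)%N ->
    conditional_law_on P (past_and_meas t) (executed t)
      (fun w => (dstep tr t w, dangle tr t w))
      (fun w => (uniform_from0 (step_bound B z cL cU (meas tr t w))
                 \x uniform_from0 (2 * pi))%E);
  pose_next : forall t w, (1 <= t <= T)%N -> executed t w ->
    pose_at tr t.+1 w =
    move (env tr w, rotate (pose_at tr t w) (dangle tr t w), dstep tr t w,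
          noise tr t w) }.

Definition returns (b : nat) : set Omega :=
  [set w | alg_output B z cL cU pstar n T (fun i => dstep tr i w) = b].

End run.

(* Main.v *)
(** With no source, every measurement is Poisson(B) given the past, so that,
    given the past and as long as the run goes on, each step has the reference
    law.  Hence the law of the first [t] steps, restricted to the event that
    iteration [t] is executed, is dominated by the law of an i.i.d. sample of
    size [t].  A P-value is superuniform under this i.i.d. law, so each test
    stops the run with probability at most [pstar / n], and there are [n] tests. *)

From HB Require Import structures.
Require Import Defs.
From mathcomp Require Import all_boot all_order all_algebra.
From mathcomp Require Import all_classical all_reals all_analysis.
From mathcomp Require Import measurable_realfun lra.

Set Implicit Arguments.
Unset Strict Implicit.
Unset Printing Implicit Defensive.

Import Order.TTheory GRing.Theory Num.Theory.
Import numFieldNormedType.Exports.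

Local Open Scope classical_set_scope.
Local Open Scope ring_scope.

(** * Right continuity and measurability of the Kolmogorov-Smirnov statistic *)

Section ks_stat_theory.
Context {R : realType}.
Variable mu : probability (measurableTypeR R) R.
Implicit Types (v w : seq R) (s x : R).

(** Seen as a random variable under [mu], the identity has [F] below as its cdf, so right continuity
    of cdfs transfers to [F]. *)
Let idR : measurableTypeR R -> R := idfun.

#[local] HB.instance Definition _ :=
  @isMeasurableFun.Build _ _ _ _ idR (@measurable_id _ _ setT).

Let F x : R := fine (mu `]-oo, x]%classic).
Let K v x : R := `|ecdf v x - F x|.

Lemma ks_stat_perm v w : perm_eq v w -> ks_stat mu v = ks_stat mu w.
Proof.
move=> vw; rewrite /ks_stat /ecdf (perm_size vw).
by under eq_fun do rewrite (permP vw).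
Qed.

Let F01 x : 0 <= F x <= 1.
Proof.
rewrite /F fine_ge0//= -lee_fin fineK ?probability_le1//.
by rewrite fin_num_measure.
Qed.

Let ecdf01 v x : 0 <= ecdf v x <= 1.
Proof.
rewrite /ecdf divr_ge0//=; have [->|v0] := eqVneq (size v) 0%N.
  by rewrite invr0 mulr0.
by rewrite ler_pdivrMr ?ltr0n ?lt0n// mul1r ler_nat count_size.
Qed.

Let has_sup_K v : has_sup (range (K v)).
Proof.
split; first by exists (K v 0), 0.
exists 1 => _ [x _ <-].
have /andP[? ?] := F01 x; have /andP[? ?] := ecdf01 v x.
by rewrite /K ler_norml; lra.
Qed.

Let F_rcont x : F y @[y --> x^'+] --> F x.
Proof.
have := @cdf_right_continuous _ _ _ mu (idR : {RV mu >-> R}) x.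
have fx y : cdf (idR : {RV mu >-> R}) y = (F y)%:E.
  by rewrite /F fineK ?fin_num_measure.
by rewrite fx (_ : cdf _ = EFin \o F)//; [move/fine_cvgP => []|apply/funext].
Qed.

Let count_rconst v x :
  \forall y \near x^'+, count (fun a => a <= y) v = count (fun a => a <= x) v.
Proof.
elim: v => [|a v IHv] /=; first by near=> y.
have ay : \forall y \near x^'+, (a <= y) = (a <= x).
  have [ax|xa] := leP a x.
    near=> y; apply: (le_trans ax); apply: ltW.
    by near: y; exact: nbhs_right_gt.
  near=> y; apply/negbTE; rewrite -ltNge.
  by near: y; exact: nbhs_right_lt.
near=> y; congr (_ + _)%N; first by congr nat_of_bool; near: y.
by near: y.
Unshelve. all: by end_near. Qed.

Let K_rcont v x : K v y @[y --> x^'+] --> K v x.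
Proof.
apply: cvg_norm; apply: cvgB; last exact: F_rcont.
apply: cvg_near_cst; near=> y.
by rewrite /ecdf; congr (_%:R / _); near: y; exact: count_rconst.
Unshelve. all: by end_near. Qed.

(* By right continuity, the supremum may be taken over the rationals. *)
Lemma lt_ks_stat s v : s < ks_stat mu v <->
  exists q : rat, s < `|ecdf v (ratr q) - fine (mu `]-oo, ratr q]%classic)|.
Proof.
split=> [sv|[q sq]]; last first.
  apply: (lt_le_trans sq); apply: sup_ubound; last by exists (ratr q).
  by case: (has_sup_K v).
have [_ [x _ <-] sx] : exists2 y, range (K v) y & s < y.
  by apply: sup_gt => //; case: (has_sup_K v).
have : \forall y \near x^'+, s < K v y.
  exact: cvgr_gt (@K_rcont v x) _ sx.
move=> [e /= e0 He].
have [q] : exists q : rat, ratr q \in `]x, x + e[.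
  by apply: rat_in_itvoo; rewrite ltrDl.
rewrite in_itv/= => /andP[xq qe]; exists q; apply: He => //=.
by rewrite distrC gtr0_norm ?subr_gt0// ltrBlDl.
Qed.

(** The set where the statistic exceeds [s] is a countable union over rational points; at a fixed
    point the empirical cdf is a normalized finite sum of indicators of coordinates. *)
Lemma measurable_ks_stat k :
  measurable_fun setT (fun w : k.-tuple (measurableTypeR R) => ks_stat mu w).
Proof.
move=> mT; apply: (measurability _ (RGenOInfty.measurableE R)) => //.
move=> _ [_ [s ->] <-]; rewrite setTI.
rewrite (_ : _ @^-1` _ = \bigcup_(q : rat) [set w : k.-tuple (measurableTypeR R) |
   s < `|ecdf w (ratr q) - F (ratr q)| ]); last first.
  apply/seteqP; split => w /=.
    by rewrite in_itv/= andbT => /lt_ks_stat[q sq]; exists q.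
  by move=> [q _ sq]; rewrite in_itv/= andbT; apply/lt_ks_stat; exists q.
apply: bigcupT_measurable_rat => q.
suff mK : measurable_fun setT
    (fun w : k.-tuple (measurableTypeR R) => `|ecdf w (ratr q) - F (ratr q)|).
  rewrite (_ : [set _ | _] = setT `&` (fun w : k.-tuple (measurableTypeR R) =>
    `|ecdf w (ratr q) - F (ratr q)|) @^-1` `]s, +oo[); first exact: mK.
  by apply/seteqP; split => w /=; rewrite in_itv/= andbT => // -[].
apply: measurableT_comp => //; apply: measurable_funB => //.
rewrite (_ : (fun _ : k.-tuple _ => _) = (fun w : k.-tuple (measurableTypeR R) =>
   (\sum_(i < k) \1_(`]-oo, ratr q]) (tnth w i)) * k%:R^-1)); last first.
  apply/funext => w; rewrite /ecdf size_tuple; congr (_ / _).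
  rewrite -sum1_count big_tuple natr_sum [LHS]big_mkcond/=; apply: eq_bigr => i _.
  rewrite indicE; case: ifPn => h; first by rewrite mem_set//= in_itv.
  by rewrite memNset//= in_itv/=; exact/negP.
apply: measurable_funM => //; apply: measurable_sum => i.
exact: (measurableT_comp (measurable_indic (measurable_itv _))
  (@measurable_tnth _ (measurableTypeR R) k i)).
Qed.

End ks_stat_theory.

(** * Superuniformity of tail probabilities *)

Section superuniform.
Context {R : realType}.

(** [I] is the whole line, a closed ray or an open ray. The points [s k] are respectively [- k],
    constantly the infimum, or decreasing to the infimum from inside [I]. *)
Lemma up_closed_bigcup (I : set R) : I !=set0 ->
    (forall x y, x <= y -> I x -> I y) ->
  exists2 s : R^nat, nonincreasing_seq s & I = \bigcup_k `[s k, +oo[%classic.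
Proof.
move=> I0 upI.
suff [s ns [Is sI]] : exists2 s : R^nat, nonincreasing_seq s &
    (forall k, I (s k)) /\ forall x, I x -> exists k, s k <= x.
  exists s => //; apply/seteqP; split => [x /sI[k skx]|x [k _]].
    by exists k => //=; rewrite in_itv/= skx.
  by rewrite /= in_itv/= andbT => /upI; apply.
have [lbI|nlbI] := pselect (has_lbound I); last first.
  exists (fun k => - k%:R) => [a b ab|]; first by rewrite lerN2 ler_nat.
  split=> [k|x _].
    apply: contrapT => nIk; apply: nlbI; exists (- k%:R) => y Iy.
    by apply: contrapT => /negP; rewrite -ltNge => /ltW /upI /(_ Iy).
  by exists (Num.trunc (- x)).+1; rewrite lerNl; apply/ltW/truncnS_gt.
have [Im|nIm] := pselect (I (inf I)).
  exists (fun=> inf I) => [//|]; split=> // x Ix; exists 0%N.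
  by apply: ge_inf.
have infI x : I x -> inf I < x.
  move=> Ix; rewrite lt_neqAle ge_inf// andbT.
  by apply: contra_notN nIm => /eqP ->.
exists (fun k => inf I + k.+1%:R^-1) => [a b ab|].
  by rewrite lerD2l lef_pV2 ?posrE// ler_nat.
split=> [k|x Ix].
  have [|y Iy yk] := @inf_adherent R I k.+1%:R^-1 _ (conj I0 lbI).
    by rewrite invr_gt0.
  exact: upI (ltW yk) Iy.
by have [k ?] := ltr_add_invr (infI _ Ix); exists k; exact: ltW.
Qed.

Context d (T : measurableType d) (Q : probability T R).
Variable f : T -> R.
Hypothesis mf : measurable_fun setT f.
Local Open Scope ereal_scope.

Let mge s : measurable [set y | (s <= f y)%R].
Proof.
rewrite (_ : [set _ | _] = setT `&` f @^-1` `[s, +oo[); first exact: mf.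
by apply/seteqP; split => w /=; rewrite in_itv/= andbT => // -[].
Qed.

Let tail_le (a s t : R) : (s <= t)%R ->
  Q [set y | (s <= f y)%R] <= a%:E -> Q [set y | (t <= f y)%R] <= a%:E.
Proof.
move=> st; apply: le_trans; apply: le_measure; rewrite ?inE//.
by move=> y /=; exact: le_trans.
Qed.

(** The levels [s] whose upper tail has mass at most [a] form an upward closed set [I], and [A] is
    its preimage under [f]. So [A] is an increasing union of tails at levels of [I], each of mass at
    most [a], and continuity from below gives the bound. *)
Lemma superuniform_tail (a : R) : (0 <= a)%R ->
  let A := [set x | Q [set y | (f x <= f y)%R] <= a%:E] in
  measurable A /\ Q A <= a%:E.
Proof.
move=> a0 A.
pose I := [set s | Q [set y | (s <= f y)%R] <= a%:E].
have AI : A = f @^-1` I by [].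
have [I0|] := pselect (I !=set0); last first.
  by move=> /set0P/negP; rewrite negbK => /eqP I0; rewrite AI I0 preimage_set0 measure0.
have [s ns Is] := up_closed_bigcup I0 (@tail_le a).
have {}AI : A = \bigcup_k [set y | (s k <= f y)%R].
  rewrite AI Is preimage_bigcup; apply: eq_bigcupr => k _.
  by apply/seteqP; split => y /=; rewrite in_itv/= andbT.
have mA : measurable A by rewrite AI; exact: bigcupT_measurable.
split => //.
have : Q [set y | (s k <= f y)%R] @[k --> \oo] --> Q A.
  rewrite AI; apply: nondecreasing_cvg_mu => //; first by rewrite -AI.
  move=> k l kl; apply/subsetPset => y /=; apply: le_trans.
  exact: ns.
move=> /[dup] cA /cvg_lim <- //; apply: lime_le; first by apply/cvg_ex; exists (Q A).
apply: nearW => k.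
have : I (s k) by rewrite Is; exists k => //=; rewrite in_itv/= lexx.
by [].
Qed.

End superuniform.

(** * Symmetry and superuniformity of the P-value *)

Section ks_pvalue_theory.
Context {R : realType}.
Variable mu : probability (measurableTypeR R) R.

Lemma ks_pvalue_perm (v w : seq R) :
  perm_eq v w -> ks_pvalue mu v = ks_pvalue mu w.
Proof.
by move=> vw; rewrite /ks_pvalue (ks_stat_perm mu vw) (perm_size vw).
Qed.

(** The P-value is the upper tail probability of the statistic, evaluated at its own observed
    value. *)
Lemma ks_pvalue_superuniform k (a : R) : 0 <= a ->
  let A := [set w : k.-tuple (measurableTypeR R) | (ks_pvalue mu w <= a%:E)%E] in
  measurable A /\ (iid_law mu k A <= a%:E)%E.
Proof.
move=> a0 A.
have -> : A = [set w : k.-tuple (measurableTypeR R) |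
    (iid_law mu k [set w' : k.-tuple (measurableTypeR R) |
      (ks_stat mu w <= ks_stat mu w')%R] <= a%:E)%E].
  by rewrite /A; apply/seteqP; split => w /=; rewrite /ks_pvalue size_tuple.
exact: (superuniform_tail (iid_law mu k) (@measurable_ks_stat _ mu k)).
Qed.

End ks_pvalue_theory.

(** * Integration of a function of a discrete variable *)

Section integral_discrete.
Context d (T : measurableType d) (R : realType) (m : {measure set T -> \bar R}).
Local Open Scope ereal_scope.

(** [A] is cut into the countably many fibres of [N], on each of which the integrand is constant. *)
Lemma ge0_integral_comp_nat (A : set T) (N : T -> nat) (h : nat -> \bar R) :
    measurable A -> measurable_fun setT N -> (forall k, 0 <= h k) ->
  \int[m]_(w in A) h (N w) = \sum_(k <oo) h k * m (A `&` N @^-1` [set k]).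
Proof.
move=> mA mN h0.
have mF k : measurable (A `&` N @^-1` [set k]).
  by apply: measurableI => //; rewrite -[X in measurable X]setTI; exact: mN.
have AE : A = \bigcup_k (A `&` N @^-1` [set k]).
  apply/seteqP; split => [w Aw|w [k _ []]//].
  by exists (N w).
rewrite [in LHS]AE ge0_integral_bigcup//; last 2 first.
- by rewrite -AE; apply: measurable_funTS; apply: measurableT_comp.
- apply/trivIsetP => i j _ _ ij; apply/seteqP; split => // w [[_ /= Ni] [_ /= Nj]].
  by move: ij; rewrite -Ni -Nj eqxx.
apply: eq_eseriesr => k _.
under eq_integral.
  move=> w; rewrite inE => -[_ /= ->]; over.
by rewrite integral_cst.
Qed.

End integral_discrete.

(** * Domination of a joint law by a product measure *)

Section joint_law_bound.
Context d d1 d2 (Omega : measurableType d) (T1 : measurableType d1)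
  (T2 : measurableType d2) (R : realType) (P : probability Omega R).
Local Open Scope ereal_scope.

(* The measurability proofs are arguments so that the measure instance can be
   inferred from the term. *)
Definition law_on d' (T : measurableType d') (D : set Omega) (mD : measurable D)
    (X : Omega -> T) (mX : measurable_fun setT X) : set T -> \bar R :=
  fun A => P (D `&` X @^-1` A).

Section law_on_measure.
Context d' (T : measurableType d') (D : set Omega) (mD : measurable D)
    (X : Omega -> T) (mX : measurable_fun setT X).
Let m := law_on mD mX.

Let mXA A : measurable A -> measurable (D `&` X @^-1` A).
Proof.
by move=> mA; apply: measurableI => //; rewrite -[X in measurable X]setTI; exact: mX.
Qed.

Let m0 : m set0 = 0.
Proof. by rewrite /m /law_on preimage_set0 setI0 measure0. Qed.

Let m_ge0 A : 0 <= m A.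
Proof. exact: measure_ge0. Qed.

Let m_sigma_additive : semi_sigma_additive m.
Proof.
move=> F mF tF mUF; rewrite /m /law_on preimage_bigcup setI_bigcupr.
apply: measure_semi_sigma_additive.
- by move=> n; exact: mXA.
- apply/trivIsetP => i j _ _ ij.
  rewrite setIACA setIid -preimage_setI.
  by move/trivIsetP : tF => ->//; rewrite preimage_set0 setI0.
- by rewrite -setI_bigcupr -preimage_bigcup; exact: mXA.
Qed.

HB.instance Definition _ := isMeasure.Build _ _ _ (law_on mD mX)
  m0 m_ge0 m_sigma_additive.

Let m_fin : fin_num_fun (law_on mD mX).
Proof. by move=> A mA; apply: fin_num_measure; exact: mXA. Qed.

HB.instance Definition _ := Measure_isFinite.Build _ _ _ (law_on mD mX) m_fin.

End law_on_measure.

(** On rectangles the joint law on [D] factors as [m1] times the law of [Y] on [D], so by uniqueness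
    it is their product measure. Replacing the second factor by [m2] enlarges the measure of every
    section. *)
Lemma joint_law_le (D : set Omega) (X : Omega -> T1) (Y : Omega -> T2)
    (m1 : probability T1 R) (m2 : probability T2 R) :
  measurable D -> measurable_fun setT X -> measurable_fun setT Y ->
  (forall A B, measurable A -> measurable B ->
    P (D `&` Y @^-1` B `&` X @^-1` A) = P (D `&` Y @^-1` B) * m1 A) ->
  (forall B, measurable B -> P (D `&` Y @^-1` B) <= m2 B) ->
  forall S, measurable S ->
    P (D `&` (fun w => (X w, Y w)) @^-1` S) <= (m1 \x m2) S.
Proof.
move=> mD mX mY XY Y2 S mS.
have mXY : measurable_fun setT (fun w => (X w, Y w)) by exact: measurable_fun_pair.
have <- : (m1 \x law_on mD mY) S = P (D `&` (fun w => (X w, Y w)) @^-1` S).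
  apply: (@product_measure_unique _ _ _ _ _ m1 (law_on mD mY) (law_on mD mXY)) => //.
  move=> A B mA mB; rewrite muleC -XY//; congr (P _).
  by apply/seteqP; split => w /=; tauto.
rewrite /product_measure1; apply: ge0_le_integral => //.
- exact: (measurable_fun_xsection (law_on mD mY)).
- exact: (measurable_fun_xsection m2).
- by move=> x _; apply: Y2; exact: measurable_xsection.
Qed.

End joint_law_bound.

(** * The stopping rule as a function of the steps *)

Section algorithm_theory.
Context {R : realType}.
Variables (B z cL cU pstar : R) (n T : nat).
Hypotheses (pstar_lt1 : pstar < 1) (n_gt0 : (0 < n)%N).

Let ref := ref_law B z cL cU.
Let run := alg_run B z cL cU pstar n T.

(* The steps are listed in reverse order, because [iid_law] adds new
   observations at the head; the P-value does not depend on the order. *)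
Fixpoint rev_steps (ds : nat -> R) (t : nat) : t.-tuple (measurableTypeR R) :=
  match t with
  | 0%N => [tuple]
  | k.+1 => cons_pair (ds k.+1, rev_steps ds k)
  end.

(** Invariant of a run in progress: no earlier test has brought the running minimum down to the
    threshold, so only the current P-value can stop the run. *)
Let running_state ds t : ~~ stopped (run ds t) ->
  steps (run ds t) = rev (rev_steps ds t) /\ ((pstar / n%:R)%:E < plow (run ds t))%E.
Proof.
elim: t => [_|t IHt] /=.
  (* The initial value of [plow] is 1, and [pstar < 1 <= n]. *)
  split=> //; rewrite lte_fin ltr_pdivrMr ?ltr0n// mul1r.
  by apply: (lt_le_trans pstar_lt1); rewrite ler1n.
rewrite /alg_step; case: ifPn => [->//|/IHt[-> _]] /=.
by rewrite -ltNge => ->; rewrite rev_cons.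
Qed.

Lemma stopped_alg_runS ds t : stopped (run ds t.+1) =
  stopped (run ds t) || (T %/ n %| t.+1)%N &&
    (ks_pvalue ref (rev_steps ds t.+1) <= (pstar / n%:R)%:E)%E.
Proof.
rewrite /= /alg_step; case: ifPn => [->//|run_t].
have [-> plow_gt] := running_state run_t; rewrite /=.
have -> : ks_pvalue (ref_law B z cL cU) (rcons (rev (rev_steps ds t)) (ds t.+1)) =
          ks_pvalue ref (ds t.+1 :: rev_steps ds t).
  by apply: ks_pvalue_perm; rewrite -rev_cons perm_rev.
case: ifP => _ /=; last by rewrite leNgt plow_gt.
by rewrite ge_min [X in X || _]leNgt plow_gt.
Qed.

Section measurability.
Context d (Omega : measurableType d).
Variable ds : nat -> Omega -> measurableTypeR R.

Lemma measurable_rev_steps t :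
  (forall i, (1 <= i <= t)%N -> measurable_fun setT (ds i)) ->
  measurable_fun setT (fun w => rev_steps (ds^~ w) t).
Proof.
elim: t => [_|t IHt mds] /=; first exact: measurable_cst.
apply: measurable_cons; first by apply: mds; rewrite leqnn.
by apply: IHt => i /andP[i1 it]; apply: mds; rewrite i1 ltnW.
Qed.

(** The space [Omega] is arbitrary here so that it can later carry the sigma-algebra of the past:
    execution of an iteration is then itself a past event. *)
Lemma measurable_running t : 0 < pstar ->
  (forall i, (1 <= i <= t)%N -> measurable_fun setT (ds i)) ->
  measurable [set w | ~~ stopped (run (ds^~ w) t)].
Proof.
move=> pstar_gt0; elim: t => [_|t IHt mds].
  by rewrite (_ : [set _ | _] = setT)//; apply/seteqP.
pose A := [set w : t.+1.-tuple (measurableTypeR R) |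
  (ks_pvalue ref w <= (pstar / n%:R)%:E)%E].
have mA : measurable A.
  by apply: (ks_pvalue_superuniform ref t.+1 _).1; rewrite divr_ge0// ltW.
have mR : measurable [set w | ~~ stopped (run (ds^~ w) t)].
  by apply: IHt => i /andP[i1 it]; apply: mds; rewrite i1 ltnW.
have mWA : measurable ((fun w => rev_steps (ds^~ w) t.+1) @^-1` A).
  by rewrite -[X in measurable X]setTI; exact: measurable_rev_steps.
under eq_set do rewrite stopped_alg_runS negb_or.
have [dt|dt] := boolP (T %/ n %| t.+1)%N; last first.
  by under eq_set do rewrite andbT.
rewrite (_ : [set _ | _] = [set w | ~~ stopped (run (ds^~ w) t)] `&`
    ~` ((fun w => rev_steps (ds^~ w) t.+1) @^-1` A)).
  by apply: measurableI => //; exact: measurableC.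
by apply/seteqP; split => w /= => [/andP[-> /negP]|[-> /negP]].
Qed.

End measurability.

End algorithm_theory.

(** * Law of the steps and stopping probability without a source *)

Section source_free_run.
Context (R : realType).
Variables (B z cL cU pstar : R) (n T : nat).
Hypotheses (pstar_gt0 : 0 < pstar) (pstar_lt1 : pstar < 1) (n_gt0 : (0 < n)%N).
Context (dE dX d : measure_display)
  (E : measurableType dE) (X : measurableType dX) (Omega : measurableType d)
  (P : probability Omega R).
Variables (strength : E -> R) (g : R -> R -> R -> R).
Hypothesis g_no_source : forall x y, g 0 x y = 0.
Variables (move : E * pose_type R * measurableTypeR R * X -> pose_type R)
  (tr : trajectory E X P).
Hypothesis tr_run : is_run B z cL cU pstar n T strength g move tr.
Hypothesis no_source : forall w, strength (env tr w) = 0.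

Local Open Scope ereal_scope.

Let ref := ref_law B z cL cU.
Let exec := executed B z cL cU pstar n T tr.
Let W t w : t.-tuple (measurableTypeR R) := rev_steps (fun i => dstep tr i w) t.

Let preimages_measurable d' (Y : measurableType d') (Z : {RV P >-> Y}) :
  preimages Z `<=` measurable.
Proof. by move=> _ [U mU <-]; exact: measurable_funPT. Qed.

Let past_measurable t : past tr t `<=` measurable.
Proof.
apply: smallest_sub; first exact: sigma_algebra_measurable.
move=> A [[|]|]; first exact: preimages_measurable.
  by move=> [i _]; exact: preimages_measurable.
by move=> [i _] [[[|]|]|]; exact: preimages_measurable.
Qed.

(** Since [past tr t] is already a sigma-algebra, measurability in the space it generates is
    membership in it. *)
Let past_sigma t : (past tr t).-sigma.-measurable = past tr t.
Proof. exact/sigma_algebra_id/smallest_sigma_algebra. Qed.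

Let past_dstep t i : (1 <= i < t)%N ->
  measurable_fun [set: g_sigma_algebraType (past tr t)] (dstep tr i).
Proof.
move=> it _ U mU; rewrite setTI past_sigma; apply: sub_sigma_algebra; right.
by exists i => //; left; left; right; exists U; rewrite ?setTI.
Qed.

Let executed_past t : past tr t (exec t).
Proof.
rewrite -past_sigma; apply: measurable_running => // i /andP[i1 it].
(* [exec t] depends only on the steps of index at most [t.-1]; there are none for [t = 0]. *)
apply: past_dstep; rewrite i1 /=; case: t it => [|t]//=.
by rewrite leqNgt i1.
Qed.

Let measurable_executed t : measurable (exec t).
Proof. apply: (@past_measurable t); exact: executed_past. Qed.

Let past_W t (A : set (t.-tuple (measurableTypeR R))) :
  measurable A -> past tr t.+1 (W t @^-1` A).
Proof.
move=> mA; rewrite -past_sigma -[X in measurable X]setTI.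
by apply: (measurable_rev_steps _ _ mA) => // i it; exact: past_dstep.
Qed.

Let measurable_W t : measurable_fun setT (W t).
Proof. by apply: measurable_rev_steps => i _. Qed.

Let measurable_preW t (A : set (t.-tuple (measurableTypeR R))) :
  measurable A -> measurable (W t @^-1` A).
Proof.
by move=> mA; rewrite -[X in measurable X]setTI; exact: measurable_W.
Qed.

(* The law of the step given the measurement mixes, under the source-free
   Poisson law of the measurement, to the reference law. *)
Lemma dstep_source_free t A U : (1 <= t <= T)%N ->
  past tr t A -> A `<=` exec t -> measurable U ->
  P (A `&` dstep tr t @^-1` U) = P A * ref U.
Proof.
move=> tT pA Aexec mU.
have mA := @past_measurable t _ pA.
have pmA : past_and_meas tr t A by apply: sub_sigma_algebra; left.
(* The full second factor forgets the angle drawn together with the step. *)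
have mUT : measurable (U `*` [set: measurableTypeR R]) by exact: measurableX.
have := draw_law tr_run tT pmA Aexec mUT.
rewrite (_ : _ @^-1` _ = dstep tr t @^-1` U); last first.
  by apply/seteqP; split => w //= [].
move=> ->.
pose h k := uniform_from0 (step_bound B z cL cU k) U.
under eq_integral.
  move=> w _; rewrite product_measure1E//.
  rewrite [X in _ * X](probability_setT (uniform_from0 _)) mule1; over.
rewrite (ge0_integral_comp_nat P (h := h) mA)//.
have mN k : P (A `&` meas tr t @^-1` [set k]) = P A * poisson B [set k].
  rewrite (meas_law tr_run tT pA Aexec)//.
  under eq_integral do rewrite /= no_source g_no_source addr0.
  by rewrite integral_cst// muleC.
rewrite /ref /ref_law (ge0_integral_comp_nat (poisson B) (N := id) (h := h))//.
rewrite -(fineK (fin_num_measure P A mA)) -nneseriesZl; last first.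
  by move=> k _; apply: mule_ge0.
apply: eq_eseriesr => k _; rewrite setTI preimage_id fineK ?fin_num_measure//.
by rewrite muleCA; congr (_ * _); exact: mN.
Qed.

Let executed_sub t : exec t.+2 `<=` exec t.+1.
Proof.
move=> w; apply: contra; rewrite stopped_alg_runS// => ->.
by [].
Qed.

(** Both [exec t.+1] and [W t] are determined by the past of iteration [t.+1], so the new step
    contributes an independent factor [ref]. The event remains [exec t.+1], since the test in this
    very iteration may stop the run. *)
Let law_W_succ t : (t < T)%N ->
  (forall S, measurable S -> P (exec t.+1 `&` W t @^-1` S) <= iid_law ref t S) ->
  forall S, measurable S ->
    P (exec t.+1 `&` W t.+1 @^-1` S) <= iid_law ref t.+1 S.
Proof.
move=> tT IH S mS.
have mS' : measurable (@cons_pair R t @^-1` S).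
  by rewrite -[X in measurable X]setTI; exact: measurable_cons_pair.
apply: (joint_law_le (X := dstep tr t.+1) (Y := W t) _ _ _ _ _ mS') => //.
  exact: measurable_W.
move=> A C mA mC; apply: dstep_source_free => //.
have : (past tr t.+1).-sigma.-measurable (exec t.+1 `&` W t @^-1` C).
  by apply: measurableI; rewrite past_sigma; [exact: executed_past|exact: past_W].
by rewrite past_sigma.
Qed.

(** Induction: after adding a step, passing from [exec t.+1] to the smaller event [exec t.+2] only
    loses mass. *)
Let law_W_le t : (t < T)%N ->
  forall S, measurable S -> P (exec t.+1 `&` W t @^-1` S) <= iid_law ref t S.
Proof.
elim: t => [_ S mS|t IHt tT S mS].
  (* The law of the empty sample is a point mass: the bound is 1, or [S] misses the empty tuple and
     the event is empty. *)
  rewrite /= diracE; case: (boolP (_ \in S)) => [_|S0].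
    by apply: probability_le1; apply: measurableI => //; exact: (@measurable_preW 0).
  rewrite (_ : _ `&` _ = set0) ?measure0//; apply/seteqP; split=> // w [_ /=].
  by rewrite /W /=; move/negP: S0 => + S0; apply; rewrite inE.
apply: le_trans (law_W_succ (ltnW tT) (IHt (ltnW tT)) mS).
have mWS := measurable_preW mS.
apply: le_measure; rewrite ?inE; [exact: measurableI..|].
by apply: setSI; exact: executed_sub.
Qed.

Let d_gt0 : (0 < T)%N -> (n %| T)%N -> (0 < T %/ n)%N.
Proof. by move=> T0 nT; rewrite divn_gt0// dvdn_leq. Qed.

(* [~` exec t.+1] is the event that one of the iterations 1, ..., t stops the
   run. *)
Lemma stopped_probability_le t : (0 < T)%N -> (n %| T)%N -> (t <= T)%N ->
  P (~` exec t.+1) <= ((t %/ (T %/ n))%:R * (pstar / n%:R))%:E.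
Proof.
move=> T0 nT; elim: t => [_|t IHt tT].
  rewrite div0n mul0r (_ : ~` _ = set0) ?measure0//.
  by apply/seteqP; split => // w /(_ isT).
have {}IHt := IHt (ltnW tT).
(* The quotient counts the tests made so far; it grows by one exactly when iteration [t.+1] has a
   test. *)
rewrite divnS; last exact: d_gt0.
pose A := [set w : t.+1.-tuple (measurableTypeR R) |
  ks_pvalue ref w <= (pstar / n%:R)%:E].
have a0 : (0 <= pstar / n%:R)%R by rewrite divr_ge0// ltW.
have [mA PA] := ks_pvalue_superuniform ref t.+1 a0.
have mWA := measurable_preW mA.
rewrite natrD mulrDl EFinD addeC.
have [dt|dt] := boolP (T %/ n %| t.+1)%N; last first.
  rewrite mul0r adde0; apply: le_trans IHt.
  apply: le_measure; rewrite ?inE; [exact: measurableC..|].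
  apply: subsetC => w; rewrite /exec /executed /mkset stopped_alg_runS//.
  by rewrite (negbTE dt) orbF.
rewrite mul1r.
(* Union bound: the run had stopped earlier, or iteration [t.+1] is executed and its P-value is
   small. *)
apply: (@le_trans _ _ (P (~` exec t.+1 `|` (exec t.+1 `&` W t.+1 @^-1` A)))).
  apply: le_measure; rewrite ?inE; first exact: measurableC.
    by apply: measurableU; [exact: measurableC|exact: measurableI].
  move=> w; rewrite /exec /executed /setC /mkset stopped_alg_runS// dt /=.
  move=> /negP; rewrite negbK; case: (stopped _) => /= [_|Aw]; first by left.
  by right.
apply: le_trans (measureU2 _ _ _) _; [exact: measurableC|exact: measurableI|].
apply: leeD => //; apply: le_trans PA; apply: law_W_succ => //; exact: law_W_le.
Qed.

Lemma false_positive_le : (0 < T)%N -> (n %| T)%N ->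
  P (returns B z cL cU pstar n T tr 1) <= pstar%:E.
Proof.
move=> T0 nT.
(* [exec T.+1] looks at the state after all [T] iterations. *)
rewrite (_ : returns _ _ _ _ _ _ _ _ _ = ~` exec T.+1); last first.
  apply/seteqP; split => w; rewrite /returns /exec /executed /alg_output /=.
    by case: ifP => // ->.
  by case: ifP => // ->.
apply: le_trans (stopped_probability_le T0 nT (leqnn T)) _.
have -> : (T %/ (T %/ n) = n)%N by rewrite -[X in (X %/ _)%N](divnK nT) mulKn// d_gt0.
by rewrite lee_fin mulrCA divff ?mulr1// pnatr_eq0 -lt0n.
Qed.

End source_free_run.

Theorem mainTheorem2
  (R : realType)
  (B z cL cU pstar : R) (n T : nat)
  (B_ge0 : 0 <= B) (cL_ge0 : 0 <= cL) (cL_lt_cU : cL < cU)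
  (pstar_gt0 : 0 < pstar) (pstar_lt1 : pstar < 1)
  (n_gt0 : (0 < n)%N) (T_gt0 : (0 < T)%N) (n_dvd_T : (n %| T)%N)
  (dE dX d : measure_display)
  (E : measurableType dE) (X : measurableType dX) (Omega : measurableType d)
  (P : probability Omega R)
  (strength : E -> R) (g : R -> R -> R -> R)
  (strength_ge0 : forall e, 0 <= strength e)
  (g_ge0 : forall s x y, 0 <= s -> 0 <= g s x y)
  (g_no_source : forall x y, g 0 x y = 0)
  (move : E * pose_type R * measurableTypeR R * X -> pose_type R)
  (measurable_move : measurable_fun setT move)
  (tr : trajectory E X P)
  (tr_run : is_run B z cL cU pstar n T strength g move tr)
  (no_source : forall w, strength (env tr w) = 0) :
  (P (returns B z cL cU pstar n T tr 1) <= pstar%:E)%E.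
Proof. exact: (false_positive_le pstar_gt0 pstar_lt1 n_gt0 g_no_source tr_run). Qed.
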